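(* Let $(X,d)$ be a metric space and let $G\subsetneq X$ be a domain. Then $G$ is a distance uniform domain if and only if it is a diameter uniform domain.
   Context: A domain is a nonempty open connected set. For $G\subsetneq X$ put $\delta_G(z)=\inf\{d(z,y): y\in X\setminus G\}$. A curve is a continuous map $\gamma:[a,b]\to X$, identified with its image when convenient; it joins $x$ and $y$ if $\gamma(a)=x$, $\gamma(b)=y$; it is rectifiable if its length $\sup\sum_i d(\gamma(t_i),\gamma(t_{i-1}))$ (over all partitions of $[a,b]$) is finite. For $z=\gamma(t)$ on $\gamma$, $\gamma[x,z]=\gamma|_{[a,t]}$ and $\gamma[z,y]=\gamma|_{[t,b]}$ (points on $\gamma$ are understood together with their parameter values). Let $c\ge1$. $G$ is diameter $c$-uniform if every pair $x,y\in G$ can be joined by a rectifiable curve $\gamma\subset G$ with $\operatorname{diam}(\gamma)\le c\,d(x,y)$ and $\min\{\operatorname{diam}(\gamma[x,z]),\operatorname{diam}(\gamma[z,y])\}\le c\,\delta_G(z)$ for all $z\in\gamma$. $G$ is distance $c$-uniform if every pair $x,y\in G$ can be joined by a rectifiable curve $\gamma\subset G$ with $\operatorname{diam}(\gamma)\le c\,d(x,y)$ and $\min\{d(x,z),d(z,y)\}\le c\,\delta_G(z)$ for all $z\in\gamma$. $G$ is diameter (resp. distance) uniform if it is diameter (resp. distance) $c$-uniform for some $c\ge1$. *)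

(* Defs.v *)
From mathcomp Require Import all_boot all_order all_algebra.
From mathcomp Require Import all_classical all_reals all_analysis.
Set Implicit Arguments.
Unset Strict Implicit.
Unset Printing Implicit Defensive.
Import Order.TTheory GRing.Theory Num.Theory.
Import numFieldNormedType.Exports.
Local Open Scope classical_set_scope.
Local Open Scope ring_scope.

Section uniform_domains.
Context {R : realType} {X : metricType R}.
Implicit Types (G A : set X) (x y z : X) (a b c : R) (gamma : R -> X).

Definition domain G := [/\ G !=set0, open G & connected G].

(* [inf] is the real infimum, so this is meaningful only if [G != setT]. *)
Definition dist_compl G z : R := inf [set mdist z y | y in ~` G].

Definition diam A : \bar R :=
  ereal_sup [set (mdist x y)%:E | x in A & y in A].

(* As in [variation], the partition is [a :: s]; [itv_partition a b s] makes
   it strictly increasing from [a] to [b]. *)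
Definition chain_length a b gamma (s : seq R) : R :=
  let F := gamma \o nth b (a :: s) in
  \sum_(0 <= n < size s) mdist (F n.+1) (F n).

Definition curve_length a b gamma : \bar R :=
  ereal_sup [set (chain_length a b gamma s)%:E | s in itv_partition a b].

(* A curve on [a, b] is represented by a function on R of which only the
   values on [a, b] matter. *)
Definition curve a b gamma := a <= b /\ {within `[a, b], continuous gamma}.

Definition rectifiable a b gamma := (curve_length a b gamma < +oo)%E.

Definition rectifiable_join G x y a b gamma :=
  [/\ curve a b gamma, rectifiable a b gamma, gamma @` `[a, b] `<=` G,
      gamma a = x & gamma b = y].

(* Points of the curve are taken with their parameter [t], so that the two
   subcurves are the restrictions of [gamma] to [a, t] and [t, b]. *)
Definition diameter_uniform_const c G :=
  forall x y, G x -> G y -> exists a b gamma,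
    [/\ rectifiable_join G x y a b gamma,
        (diam (gamma @` `[a, b]) <= (c * mdist x y)%:E)%E &
        forall t, t \in `[a, b] ->
          (Order.min (diam (gamma @` `[a, t])) (diam (gamma @` `[t, b]))
             <= (c * dist_compl G (gamma t))%:E)%E].

Definition distance_uniform_const c G :=
  forall x y, G x -> G y -> exists a b gamma,
    [/\ rectifiable_join G x y a b gamma,
        (diam (gamma @` `[a, b]) <= (c * mdist x y)%:E)%E &
        forall t, t \in `[a, b] ->
          Order.min (mdist x (gamma t)) (mdist (gamma t) y)
             <= c * dist_compl G (gamma t)].

Definition diameter_uniform G := exists2 c, 1 <= c & diameter_uniform_const c G.

Definition distance_uniform G := exists2 c, 1 <= c & distance_uniform_const c G.

End uniform_domains.

(* Main.v *)
(* Let r = d(x, y) / 2. Every sphere of radius s <= r about x meets a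
   distance-uniform curve from x to y in a point p with s <= c delta(p). Take
   such points at the radii r, r/2, r/4, ... until the radius is small compared
   with delta(x), and join consecutive ones by distance-uniform curves: the curve
   between radii s and 2s has diameter O(s) and stays at distance >= const * s
   from the complement, because its endpoints do. The diameters form a geometric
   series, so the finite concatenation is a curve leaving x whose traversed part
   has diameter O(delta) at every point. The same construction at y, and one more
   distance-uniform curve between the two outermost points, finish the proof. *)
Require Import Defs.
From mathcomp Require Import all_boot all_order all_algebra.
From mathcomp Require Import all_classical all_reals all_analysis.
From mathcomp Require Import ring lra.
Import numFieldNormedType.Exports.
Local Open Scope classical_set_scope.
Local Open Scope ring_scope.

Set Implicit Arguments.
Unset Strict Implicit.
Unset Printing Implicit Defensive.
Import Order.TTheory GRing.Theory Num.Theory.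

(** * Lengths of chains under splitting and reversal *)

Section chain_length.
Context {R : realType} {X : metricType R}.
Implicit Types (a b c k : R) (gamma : R -> X) (s : seq R).

Lemma chain_length_nil a b gamma : chain_length a b gamma [::] = 0.
Proof. by rewrite /chain_length /= big_nil. Qed.

Lemma chain_length_cons a b gamma x s :
  chain_length a b gamma (x :: s) =
  mdist (gamma x) (gamma a) + chain_length x b gamma s.
Proof. by rewrite /chain_length /= big_nat_recl. Qed.

Lemma chain_length_cat a b c gamma s t : itv_partition a b s ->
  chain_length a c gamma (s ++ t) =
  chain_length a b gamma s + chain_length b c gamma t.
Proof.
elim: s a => [|x s ih] a abs.
  by rewrite (itv_partition_nil abs) chain_length_nil add0r.
by rewrite /= !chain_length_cons (ih x (itv_partition_cons abs)) addrA.
Qed.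

Lemma eq_chain_length a b gamma gamma' s : itv_partition a b s ->
  {in `[a, b], gamma =1 gamma'} ->
  chain_length a b gamma s = chain_length a b gamma' s.
Proof.
elim: s a => [|x s ih] a abs eqg; first by rewrite !chain_length_nil.
have xbs := itv_partition_cons abs.
have xb := itv_partition_le xbs.
have ax : a < x by case: abs => /= /andP[].
rewrite !chain_length_cons (ih x)//; last first.
  move=> u; rewrite in_itv/= => /andP[xu ub].
  by rewrite eqg// in_itv/= ub (le_trans (ltW ax)).
by rewrite !eqg// in_itv/= ?lexx ?(ltW ax) ?xb// (le_trans (ltW ax)).
Qed.

(** Inserting the point [b] into a partition only lengthens the chain, by the triangle inequality,
    and the refined partition breaks at [b]. This bounds the length of a concatenation. *)
Lemma chain_length_split a b c gamma s : a <= b -> b <= c ->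
  itv_partition a c s ->
  exists s1 s2, [/\ itv_partition a b s1, itv_partition b c s2 &
    chain_length a c gamma s <=
    chain_length a b gamma s1 + chain_length b c gamma s2].
Proof.
move=> + bc; elim: s a => [|x s ih] a ab acs.
  have ac := itv_partition_nil acs.
  have <- : a = b by apply/eqP; rewrite eq_le ab ac.
  exists [::], [::]; split => //.
  by rewrite !chain_length_nil addr0.
have ax : a < x by case: acs => /= /andP[].
have xcs := itv_partition_cons acs.
have [xb|bx] := leP x b.
  have [s1 [s2 [[p1 l1] ps2 le12]]] := ih x xb xcs.
  exists (x :: s1), s2; split => //; first by split; rewrite //= ax.
  by rewrite !chain_length_cons -addrA lerD2l.
have bcs : itv_partition b c (x :: s) by case: xcs => ? ?; split; rewrite //= bx.
(* Partitions increase strictly, so [b] can be inserted only if [a < b]; if [a = b], the left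
   partition is empty. *)
move: ab; rewrite le_eqVlt => /predU1P[abE|ab].
  exists [::], (x :: s); split => //; first by split => //=; apply/eqP.
  by rewrite chain_length_nil add0r abE.
exists [:: b], (x :: s); split => //; first exact: itv_partition1.
rewrite !chain_length_cons chain_length_nil addr0 addrA lerD2r addrC.
exact: metric_triangle.
Qed.

Lemma chain_length_rev k a b gamma s : itv_partition a b s ->
  exists2 s', itv_partition (k - b) (k - a) s' &
    chain_length a b (fun t => gamma (k - t)) s =
    chain_length (k - b) (k - a) gamma s'.
Proof.
elim: s a => [|x s ih] a abs.
  rewrite (itv_partition_nil abs); exists [::]; first by split => /=.
  by rewrite !chain_length_nil.
have ax : a < x by case: abs => /= /andP[].
have [s' ps' es'] := ih x (itv_partition_cons abs).
have p1 : itv_partition (k - x) (k - a) [:: k - a].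
  by apply: itv_partition1; rewrite ltrD2l ltrN2.
(* Under reflection the first step of the chain becomes the last. *)
exists (s' ++ [:: k - a]); first exact: itv_partition_cat ps' p1.
rewrite (chain_length_cat _ _ _ ps') !chain_length_cons chain_length_nil es' addr0.
by rewrite addrC metric_sym.
Qed.

Lemma rectifiableP a b gamma : rectifiable a b gamma <->
  exists M : R, forall s, itv_partition a b s -> chain_length a b gamma s <= M.
Proof.
split=> [rec|[M leM]].
  exists (fine (curve_length a b gamma)) => s abs.
  have le : ((chain_length a b gamma s)%:E <= curve_length a b gamma)%E.
    by apply: ereal_sup_ubound; exists s.
  rewrite -lee_fin fineK// fin_numElt; apply/andP; split => //.
  by apply: lt_le_trans le; rewrite ltNyr.
apply: (@le_lt_trans _ _ M%:E); last by rewrite ltry.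
by apply: ge_ereal_sup => _ [s abs <-]; rewrite lee_fin; exact: leM.
Qed.

End chain_length.

(** * Distance to the complement, and concatenation of curves *)

Section curves.
Context {R : realType} {X : metricType R}.
Implicit Types (G : set X) (x y p q : X) (a b c k D M r s t u : R) (gamma : R -> X).

Lemma diam_imageP a b gamma D : (diam (gamma @` `[a, b]) <= D%:E)%E <->
  {in `[a, b] &, forall s t, mdist (gamma s) (gamma t) <= D}.
Proof.
split=> [leD s t sab tab|leD].
  rewrite -lee_fin; apply: le_trans leD; apply: ereal_sup_ubound.
  by exists (gamma s); [exists s|exists (gamma t) => //; exists t].
apply: ge_ereal_sup => _ [_ [s sab <-] [_ [t tab <-] <-]].
by rewrite lee_fin leD.
Qed.

Lemma dist_compl_lip G x y : G `<` setT ->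
  dist_compl G x <= dist_compl G y + mdist x y.
Proof.
move=> [_ /nonsubset[w [_ Gw]]]; rewrite -lerBlDr; apply: lb_le_inf.
  by exists (mdist y w); exists w.
move=> _ [v Gv <-]; rewrite lerBlDr addrC.
apply: le_trans (metric_triangle x y v).
apply: ge_inf; last by exists v.
by exists 0 => _ [z _ <-]; exact: mdist_ge0.
Qed.

Lemma dist_compl_gt0 G x : G `<` setT -> open G -> G x -> 0 < dist_compl G x.
Proof.
move=> [_ /nonsubset[w [_ Gw]]] oG Gx.
have /metricType_numDomainType.nbhs_mdistP[e /= e0 eG] : nbhs x G by exact: open_nbhs_nbhs.
apply: (lt_le_trans e0); apply: lb_le_inf; first by exists (mdist x w), w.
by move=> _ [y Gy <-]; rewrite leNgt; apply/negP => /eG.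
Qed.

Lemma mdist_dist_le x y z : `|mdist x y - mdist x z| <= mdist y z.
Proof.
have := metric_triangle x y z; have := metric_triangle x z y.
rewrite (metric_sym z) ler_norml; lra.
Qed.

Lemma mdist_IVT x a b r gamma : curve a b gamma ->
  mdist x (gamma a) <= r <= mdist x (gamma b) ->
  exists2 t, t \in `[a, b] & mdist x (gamma t) = r.
Proof.
move=> [ab cg] rab.
have cf : {within `[a, b], continuous (fun t => mdist x (gamma t))}.
  apply/subspace_continuousP => t tab.
  apply/cvgrPdist_lt => e e0.
  move/subspace_continuousP : cg => /(_ t tab) /metricType_numDomainType.cvgr_dist_lt.
  move=> /(_ _ e0); apply: filterS => u du.
  exact: le_lt_trans (mdist_dist_le _ _ _) du.
have rminmax : Num.min (mdist x (gamma a)) (mdist x (gamma b)) <= r <=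
    Num.max (mdist x (gamma a)) (mdist x (gamma b)).
  by move: rab => /andP[ra rb]; rewrite ge_min ra le_max rb orbT.
by have [t tab <-] := IVT ab cf rminmax; exists t.
Qed.

Lemma within_continuous_rev k a b gamma :
  {within `[k - b, k - a], continuous gamma} ->
  {within `[a, b], continuous (fun t => gamma (k - t))}.
Proof.
move=> /subspace_continuousP cg; apply/subspace_continuousP => t tab.
have tk : `[k - b, k - a]%classic (k - t).
  by move: tab; rewrite /= !in_itv/= !lerD2l !lerN2 andbC.
move=> P /(cg _ tk) gP.
have ck : (fun u : R => k - u) @ t --> k - t by exact: (cvgB (cvg_cst k) cvg_id).
apply: (@filterS R (nbhs t) _ _ _ _ (ck _ gP)) => u /= gPu uab; apply: gPu.
by move: uab; rewrite /= !in_itv/= !lerD2l !lerN2 andbC.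
Qed.

(** The second curve is run backwards, because the two curves to be joined end at a common point.
    With [k = b + b'], its end [b'] falls at parameter [b]. *)
Definition paste b k (gamma1 gamma2 : R -> X) t :=
  if t <= b then gamma1 t else gamma2 (k - t).

Section paste.
Variables (G : set X) (x y p : X) (a b a' b' : R) (gamma1 gamma2 : R -> X).
Hypotheses (join1 : rectifiable_join G x p a b gamma1)
  (join2 : rectifiable_join G y p a' b' gamma2).

Local Notation k := (b + b').
Local Notation e := (k - a').
Local Notation gamma := (paste b k gamma1 gamma2).

Lemma pasteL t : t <= b -> gamma t = gamma1 t.
Proof. by rewrite /paste => ->. Qed.

Lemma pasteR t : b <= t -> gamma t = gamma2 (k - t).
Proof.
rewrite /paste le_eqVlt => /predU1P[<-|]; last by rewrite ltNge => /negbTE ->.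
by rewrite lexx addrAC subrr add0r; case: join1 => _ _ _ _ ->; case: join2.
Qed.

Lemma paste_bounds : a <= b /\ b <= e.
Proof.
have [[ab _] _ _ _ _] := join1; have [[ab' _] _ _ _ _] := join2.
by split => //; lra.
Qed.

Lemma rectifiable_join_paste : rectifiable_join G x y a e gamma.
Proof.
have [ab be] := paste_bounds.
have [[_ c1] r1 G1 g1a g1b] := join1; have [[ab' c2] r2 G2 g2a g2b] := join2.
have ke : k - e = a' by lra.
have kb : k - b = b' by lra.
split.
- split; first exact: le_trans be.
  have -> : `[a, e]%classic = `[a, b] `|` `[b, e].
    apply/seteqP; split => t /=; rewrite !in_itv/=; last by case=> /andP[]; lra.
    move=> /andP[at_ te]; have [tb|bt] := leP t b; first by left; lra.
    by right; lra.
  apply: withinU_continuous; [exact: itv_closed|exact: itv_closed| |].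
    apply: subspace_eq_continuous c1 => t; rewrite inE/= in_itv/= => /andP[_ tb].
    exact: esym (pasteL tb).
  have c2' : {within `[b, e], continuous (fun t => gamma2 (k - t))}.
    by apply: within_continuous_rev; rewrite ke kb.
  apply: subspace_eq_continuous c2' => t; rewrite inE/= in_itv/= => /andP[bt _].
  exact: esym (pasteR bt).
- have [M1 leM1] := (rectifiableP _ _ _).1 r1.
  have [M2 leM2] := (rectifiableP _ _ _).1 r2.
  apply/rectifiableP; exists (M1 + M2) => s.
  move=> /(chain_length_split gamma ab be)[s1 [s2 [ps1 ps2]]].
  move=> /le_trans; apply; apply: lerD.
    rewrite (@eq_chain_length _ _ _ _ _ gamma1 _ ps1) ?leM1// => t.
    by rewrite in_itv/= => /andP[_]; exact: pasteL.
  rewrite (@eq_chain_length _ _ _ _ _ (fun t => gamma2 (k - t)) _ ps2); last first.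
    by move=> t; rewrite in_itv/= => /andP[+ _]; exact: pasteR.
  have [s' + ->] := chain_length_rev k gamma2 ps2.
  by rewrite ke kb; exact: leM2.
- move=> _ [t + <-]; rewrite /= in_itv/= => /andP[at_ te].
  have [tb|bt] := leP t b.
    by rewrite pasteL//; apply: G1; exists t; rewrite //= in_itv/= at_.
  rewrite pasteR ?ltW//; apply: G2; exists (k - t) => //=.
  by rewrite in_itv/=; lra.
- by rewrite pasteL.
- by rewrite pasteR// ke.
Qed.

(** Points on different pieces are compared through the common endpoint [p], which lies on both. *)
Lemma diam_paste D1 D2 :
  {in `[a, b] &, forall s t, mdist (gamma1 s) (gamma1 t) <= D1} ->
  {in `[a', b'] &, forall s t, mdist (gamma2 s) (gamma2 t) <= D2} ->
  {in `[a, e] &, forall s t, mdist (gamma s) (gamma t) <= D1 + D2}.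
Proof.
move=> le1 le2.
have [ab be] := paste_bounds.
have [_ _ _ _ g1b] := join1; have [[ab' _] _ _ _ g2b] := join2.
have bab : b \in `[a, b] by rewrite in_itv/= ab lexx.
have b'ab : b' \in `[a', b'] by rewrite in_itv/= ab' lexx.
have D1_ge0 : 0 <= D1 by apply: le_trans (le1 b b bab bab); exact: mdist_ge0.
have D2_ge0 : 0 <= D2 by apply: le_trans (le2 b' b' b'ab b'ab); exact: mdist_ge0.
have mixed s t : s \in `[a, b] -> k - t \in `[a', b'] ->
    mdist (gamma1 s) (gamma2 (k - t)) <= D1 + D2.
  move=> sab tab; apply: (le_trans (metric_triangle _ p _)); apply: lerD.
    by rewrite -g1b le1.
  by rewrite -g2b le2.
move=> s t; rewrite !in_itv/= => /andP[as_ se] /andP[at_ te].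
have [sb|bs] := leP s b; have [tb|bt] := leP t b.
- rewrite !pasteL//; apply: (@le_trans _ _ D1); last by rewrite lerDl.
  by rewrite le1// in_itv/= ?as_ ?at_.
- rewrite (pasteL sb) (pasteR (ltW bt)).
  by apply: mixed; rewrite in_itv/=; lra.
- rewrite (pasteL tb) (pasteR (ltW bs)) metric_sym.
  by apply: mixed; rewrite in_itv/=; lra.
- rewrite (pasteR (ltW bt)) (pasteR (ltW bs)).
  apply: (@le_trans _ _ D2); last by rewrite lerDr.
  by apply: le2; rewrite in_itv/=; lra.
Qed.

End paste.
End curves.

(** Chosen so that [carrot_const c * (r / c) = 7 * c * r * (1 + c)], which is what [carrot_extend]
    requires for the middle curve of the final construction. *)
Definition carrot_const {R : realType} (c : R) : R := 7 * c ^+ 2 * (1 + c).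

(** * From distance uniformity to diameter uniformity *)

Section distance_to_diameter.
Context {R : realType} {X : metricType R}.
Variables (G : set X) (c : R).
Hypotheses (GT : G `<` setT) (oG : open G) (c_ge1 : 1 <= c)
  (unifG : distance_uniform_const c G).
Implicit Types (x y p q : X) (a b r s t u D E rho : R) (gamma : R -> X).

Local Notation delta := (dist_compl G).

Local Notation C := (carrot_const c).

Let c_gt0 : 0 < c. Proof. exact: lt_le_trans c_ge1. Qed.

Let C_ge1 : 1 <= C. Proof. by rewrite /carrot_const !mulr_ege1 ?exprn_ege1 ?lerDl ?ler1n// ltW. Qed.

(** A one-sided diameter condition: only the part traversed since [x] is measured. The bound [D] on
    the whole diameter is what accumulates when a carrot is extended. *)
Definition carrot D x y := exists a b gamma, [/\ rectifiable_join G x y a b gamma,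
  {in `[a, b] &, forall s t, mdist (gamma s) (gamma t) <= D} &
  forall u, u \in `[a, b] ->
    {in `[a, u] &, forall s t, mdist (gamma s) (gamma t) <= C * delta (gamma u)}].

(** A uniform curve crosses the sphere by the intermediate value theorem. As [2 * r <= mdist x y],
    the crossing point is no closer to [y] than to [x], so the minimum in the distance condition
    equals [r]. *)
Lemma exists_point_at_mdist x y r : G x -> G y -> 0 <= r -> 2 * r <= mdist x y ->
  exists p, [/\ G p, mdist x p = r & r <= c * delta p].
Proof.
move=> Gx Gy r0 rxy.
have [a [b [gamma [[cg _ gG ga gb] _ gmin]]]] := unifG Gx Gy.
have [|t tab xt] := @mdist_IVT _ _ x a b r gamma cg.
  by rewrite ga gb mdistxx r0/=; lra.
exists (gamma t); split => //; first by apply: gG; exists t.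
apply: le_trans (gmin t tab); rewrite xt le_min lexx/=.
by have := metric_triangle x (gamma t) y; rewrite xt; lra.
Qed.

(** A point [z] of the uniform curve is within [c * delta z] of an endpoint, so the Lipschitz bound
    on [delta] gives [rho <= delta z + c * delta z]. *)
Lemma uniform_join_away x y rho : G x -> G y -> rho <= delta x -> rho <= delta y ->
  exists a b gamma, [/\ rectifiable_join G x y a b gamma,
    {in `[a, b] &, forall s t, mdist (gamma s) (gamma t) <= c * mdist x y} &
    {in `[a, b], forall t, rho <= (1 + c) * delta (gamma t)}].
Proof.
move=> Gx Gy rx ry.
have [a [b [gamma [jg /diam_imageP dg gmin]]]] := unifG Gx Gy.
exists a, b, gamma; split => // t /gmin; rewrite ge_min => /orP[] le.
- by have := dist_compl_lip x (gamma t) GT; lra.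
- by have := dist_compl_lip y (gamma t) GT; rewrite metric_sym; lra.
Qed.

(** On the old piece the carrot condition is inherited. On the new piece the traversed part has
    diameter at most [E], while [delta] is at least [rho / (1 + c)]. *)
Lemma carrot_extend D E rho x p q : G p -> G q -> carrot D x p ->
  rho <= delta p -> rho <= delta q ->
  D + c * mdist p q <= E -> E * (1 + c) <= C * rho -> carrot E x q.
Proof.
move=> Gp Gq [a [b [g1 [j1 d1 C1]]]] rp rq DE Erho.
(* The new curve goes from [q] to [p], since [paste] reverses it. *)
have [a' [b' [g2 [j2 d2 away]]]] := uniform_join_away Gq Gp rq rp.
have [ab be] := paste_bounds j1 j2.
have dpaste := diam_paste j1 j2 d1 d2.
rewrite (metric_sym q) in dpaste.
exists a, (b + b' - a'), (paste b (b + b') g1 g2); split.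
- exact: (rectifiable_join_paste j1 j2).
- by move=> s t sab tab; apply: le_trans DE; exact: dpaste.
move=> u; rewrite in_itv/= => /andP[au ue].
have [ub|bu] := leP u b => s t; rewrite !in_itv/= => /andP[as_ su] /andP[at_ tu].
  rewrite !pasteL ?(le_trans _ ub)//.
  by apply: C1; rewrite in_itv/= ?au ?as_ ?at_.
apply: (@le_trans _ _ E).
  by apply: le_trans DE; apply: dpaste; rewrite in_itv/= ?as_ ?at_ (le_trans _ ue).
rewrite (pasteR j1 j2 (ltW bu)).
have uab : b + b' - u \in `[a', b'] by rewrite in_itv/=; lra.
have := away _ uab; set d := delta _ => rd.
have c1 : 0 < 1 + c by rewrite addr_gt0.
rewrite -(ler_pM2r c1) -mulrA (mulrC d); apply: (le_trans Erho).
by rewrite ler_pM2l// (lt_le_trans _ C_ge1).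
Qed.

(** The curve stays within [c * mdist x y] of [x], at most half of [delta x]. Hence [delta] along it
    is at least [c * mdist x y], which also bounds its diameter. *)
Lemma carrot_near x y : G x -> G y -> 2 * c * mdist x y <= delta x ->
  carrot (c * mdist x y) x y.
Proof.
move=> Gx Gy xy.
have [a [b [g [jg /diam_imageP dg _]]]] := unifG Gx Gy.
have [[ab _] _ _ ga _] := jg.
exists a, b, g; split => // u uab s t sau tau.
have aab : a \in `[a, b] by rewrite in_itv/= lexx.
have gu := dg a u aab uab.
have := dist_compl_lip x (g u) GT; rewrite -{2}ga => lip.
have d_ge : c * mdist x y <= delta (g u) by lra.
have d0 : 0 <= delta (g u).
  by apply: le_trans d_ge; rewrite mulr_ge0 ?mdist_ge0// ltW.
apply: (@le_trans _ _ (c * mdist x y)).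
  by move: uab sau tau; rewrite !in_itv/= => ? ? ?; apply: dg; rewrite in_itv/=; lra.
by apply: (le_trans d_ge); rewrite ler_peMl.
Qed.

(* Induction on the number of halvings of [mdist x y] that bring the starting
   point of the curve within the scale [dist_compl G x] of [carrot_near]. *)
Lemma carrot_exists n x y : G x -> G y -> mdist x y <= c * delta y ->
  (forall r, 0 <= r <= mdist x y ->
     exists p, [/\ G p, mdist x p = r & r <= c * delta p]) ->
  2 * c * mdist x y <= 2 ^+ n * delta x -> carrot (3 * c * mdist x y) x y.
Proof.
move=> Gx; elim: n y => [|n ih] y Gy xy pts; have d0 := mdist_ge0 x y.
  rewrite expr0 mul1r => /(carrot_near Gx Gy)[a [b [g [jg dg Cg]]]].
  exists a, b, g; split => // s t sab tab; apply: (le_trans (dg s t sab tab)).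
  by rewrite -mulrA ler_peMl ?mulr_ge0 ?ler1n// ltW.
rewrite exprS => near_x.
have [|p [Gp xp pd]] := pts (mdist x y / 2); first by lra.
have : carrot (3 * c * mdist x p) x p.
  apply: ih => //; first by rewrite xp.
    by move=> r; rewrite xp => r_le; apply: pts; lra.
  by rewrite xp; lra.
rewrite xp => carp.
(* The carrot up to [p] and the curve from [p] to [y] each contribute at most
   [3 / 2 * c * mdist x y], so the factor 3 reproduces itself. *)
have pq : mdist p y <= 3 * (mdist x y / 2).
  by have := metric_triangle p x y; rewrite (metric_sym p x) xp; lra.
have cpq : c * mdist p y <= c * (3 * (mdist x y / 2)) by rewrite ler_pM2l.
(* This [rho] comes from [mdist x y / 2 <= c * delta p]; the bound at [y] is twice as good. *)
apply: (carrot_extend (rho := mdist x y / (2 * c)) Gp Gy carp).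
- by rewrite ler_pdivrMr ?mulr_gt0//; lra.
- by rewrite ler_pdivrMr ?mulr_gt0//; lra.
- lra.
have -> : C * (mdist x y / (2 * c)) = 7 / 2 * c * (1 + c) * mdist x y.
  by rewrite /carrot_const; field; rewrite gt_eqF.
have : 0 <= c * (1 + c) * mdist x y by rewrite !mulr_ge0 ?addr_ge0// ltW.
lra.
Qed.

Lemma carrot_to x y r : G x -> G y -> 0 <= r -> 2 * r <= mdist x y ->
  exists p, [/\ G p, mdist x p = r, r <= c * delta p & carrot (3 * c * r) x p].
Proof.
move=> Gx Gy r0 rxy.
have [p [Gp xp rp]] := exists_point_at_mdist Gx Gy r0 rxy.
have d0 := dist_compl_gt0 GT oG Gx.
(* [n] exceeds the ratio of the two scales and [n < 2 ^ n], so [n] halvings suffice. *)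
pose n := (Num.truncn (2 * c * mdist x p / delta x)).+1.
have le_n : 2 * c * mdist x p <= 2 ^+ n * delta x.
  rewrite -ler_pdivrMr//; apply/ltW/(lt_trans (truncnS_gt _)).
  by rewrite -natrX ltr_nat ltn_expl.
exists p; split => //; rewrite -xp; apply: (carrot_exists (n := n)) => //.
  by rewrite xp.
by move=> s s_le; apply: (exists_point_at_mdist Gx Gy); rewrite xp in s_le; lra.
Qed.

Lemma distance_diameter_uniform_const : diameter_uniform_const C G.
Proof.
move=> x y Gx Gy.
(* If [x = y], the diameter bound is zero, so the given curve is constant and already works. *)
have [xy|xy] := eqVneq x y.
  have [a [b [g [jg dg gmin]]]] := unifG Gx Gy.
  exists a, b, g; split => //.
    by move: dg; rewrite xy mdistxx !mulr0.
  move=> t tab; rewrite ge_min; apply/orP; left.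
  have [_ _ gG _ _] := jg.
  have /(dist_compl_gt0 GT oG)/ltW d0 : G (g t) by apply: gG; exists t.
  move/diam_imageP : dg; rewrite xy mdistxx mulr0 => dg.
  apply/diam_imageP => u v; rewrite !in_itv/= => ut vt.
  apply: (@le_trans _ _ 0); last by rewrite mulr_ge0// (le_trans _ C_ge1).
  by apply: dg; move: tab; rewrite !in_itv/=; lra.
have xy0 : 0 < mdist x y by rewrite mdist_gt0.
set r := mdist x y / 2.
have r0 : 0 < r by rewrite divr_gt0.
have xyE : mdist x y = 2 * r by rewrite mulrC divfK.
have rxy : 2 * r <= mdist x y by rewrite xyE.
have [p [Gp xp rp carp]] := carrot_to Gx Gy (ltW r0) rxy.
have [q [Gq yq rq carq]] : exists q,
    [/\ G q, mdist y q = r, r <= c * delta q & carrot (3 * c * r) y q].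
  by apply: (carrot_to Gy Gx (ltW r0)); rewrite metric_sym.
have pq : mdist p q <= 4 * r.
  have := metric_triangle p x q; have := metric_triangle x y q.
  by rewrite (metric_sym p x) xp yq xyE; lra.
have cpq : c * mdist p q <= c * (4 * r) by rewrite ler_pM2l.
have cr0 : 0 <= c * r by rewrite mulr_ge0// ltW.
(* The factor 7 is 3 from the carrot to [p] plus 4 from [mdist p q <= 4 * r]. *)
have {carp} [a [b [g1 [j1 d1 C1]]]] : carrot (7 * c * r) x q.
  apply: (carrot_extend (rho := r / c) Gp Gq carp).
  - by rewrite ler_pdivrMr// mulrC.
  - by rewrite ler_pdivrMr// mulrC.
  - lra.
  have -> : C * (r / c) = 7 * c * r * (1 + c) by rewrite /carrot_const; field; rewrite gt_eqF.
  by [].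
have [a' [b' [g2 [j2 d2 C2]]]] := carq.
have [ab be] := paste_bounds j1 j2.
exists a, (b + b' - a'), (paste b (b + b') g1 g2); split.
- exact: (rectifiable_join_paste j1 j2).
- apply/diam_imageP => s t sab tab; apply: (le_trans (diam_paste j1 j2 d1 d2 sab tab)).
  (* The whole diameter is at most [7 * c * r + 3 * c * r], and [10 <= 7 * c * (1 + c)] because
     [1 <= c]. *)
  have : c * r * 10 <= c * r * (7 * c * (1 + c)) by rewrite ler_wpM2l//; move: c_ge1; nra.
  by rewrite /carrot_const xyE; lra.
move=> u; rewrite in_itv/= ge_min => /andP[au ue].
(* Up to the junction the part since [x] is controlled by the first carrot. Beyond it, the remaining
   part is an initial part of the carrot from [y], run backwards. *)
have [ub|bu] := leP u b; apply/orP; [left|right]; apply/diam_imageP => s t;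
    rewrite !in_itv/= => /andP[us su] /andP[ut tu].
  by rewrite !pasteL ?(le_trans _ ub)//; apply: C1; rewrite in_itv/= ?au ?us ?ut.
have bs := le_trans (ltW bu) us; have bt := le_trans (ltW bu) ut.
rewrite (pasteR j1 j2 (ltW bu)) (pasteR j1 j2 bs) (pasteR j1 j2 bt).
by apply: C2; rewrite in_itv/=; lra.
Qed.

Lemma distance_diameter_uniform : diameter_uniform G.
Proof. by exists C => //; exact: distance_diameter_uniform_const. Qed.

End distance_to_diameter.

Theorem lemma3p6 (R : realType) (X : metricType R) (G : set X)
  (GT : G `<` setT) (domG : domain G) :
  distance_uniform G <-> diameter_uniform G.
Proof.
have [_ oG _] := domG.
split=> [[c c1]|[c c1 unifG]]; first exact: distance_diameter_uniform.
exists c => // x y Gx Gy.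
have [a [b [g [jg dg gmin]]]] := unifG x y Gx Gy.
have [[ab _] _ _ ga gb] := jg.
exists a, b, g; split => // t tab.
move: (tab); rewrite in_itv/= => /andP[at_ tb].
(* Each subcurve contains its endpoint [x] or [y], so its diameter bounds the corresponding
   distance. *)
move: (gmin t tab); rewrite !ge_min => /orP[] /diam_imageP le; apply/orP.
- by left; rewrite -ga; apply: le; rewrite in_itv/= lexx at_.
- by right; rewrite -gb; apply: le; rewrite in_itv/= lexx tb.
Qed.
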